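(* (Relational soundness.) Let $\Sigma$ be a signature and $\varphi,\psi$ formulas over $\Sigma$. If $\varphi\vdash\psi$ is derivable in $\mathsf{QRC_1}$, then for every adequate relational model $\mathcal M$ in $\Sigma$, every world $w\in W$ and every $w$-assignment $g$: if $\mathcal M,w\Vdash^g\varphi$ then $\mathcal M,w\Vdash^g\psi$.
   Context: The logic $\mathsf{QRC_1}$. Fix a countable set of variables. A signature $\Sigma$ is a set of constants and a set of relation symbols with arities (no function symbols). A term is a variable or a constant. Formulas are built from $\top$ and $S(t_0,\dots,t_{n-1})$ ($S$ $n$-ary, $t_i$ terms) by $\wedge$, the unary modality $\Diamond$, and $\forall x$. $\mathrm{fv}(\varphi)$ is the set of free variables; $\varphi[x\leftarrow t]$ is simultaneous replacement of free occurrences of $x$ by $t$; $t$ is free for $x$ in $\varphi$ if no variable of $t$ becomes bound in $\varphi[x\leftarrow t]$. $\mathsf{QRC_1}$ derives sequents $\varphi\vdash\psi$ by: (i) $\varphi\vdash\top$, $\varphi\vdash\varphi$; (ii) $\varphi\wedge\psi\vdash\varphi$, $\varphi\wedge\psi\vdash\psi$; (iii) from $\varphi\vdash\psi$, $\varphi\vdash\chi$ infer $\varphi\vdash\psi\wedge\chi$; (iv) from $\varphi\vdash\psi$, $\psi\vdash\chi$ infer $\varphi\vdash\chi$; (v) from $\varphi\vdash\psi$ infer $\Diamond\varphi\vdash\Diamond\psi$; (vi) $\Diamond\Diamond\varphi\vdash\Diamond\varphi$; (vii) $\Diamond\forall x\varphi\vdash\forall x\Diamond\varphi$; (viii) from $\varphi\vdash\psi$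 infer $\varphi\vdash\forall x\psi$ if $x\notin\mathrm{fv}(\varphi)$; (ix) from $\varphi[x\leftarrow t]\vdash\psi$ infer $\forall x\varphi\vdash\psi$ if $t$ is free for $x$ in $\varphi$; (x) from $\varphi\vdash\psi$ infer $\varphi[x\leftarrow t]\vdash\psi[x\leftarrow t]$ if $t$ is free for $x$ in $\varphi$ and $\psi$; (xi) from $\varphi[x\leftarrow c]\vdash\psi[x\leftarrow c]$ infer $\varphi\vdash\psi$ if the constant $c$ occurs in neither $\varphi$ nor $\psi$. Relational semantics. A frame is $\langle W,R,\{M_w\}_{w\in W}\rangle$ with $W$ a nonempty set of worlds, $R$ a binary relation on $W$, and each $M_w$ a finite set (the domain of $w$). A relational model in $\Sigma$ adds, for each $w$, an interpretation $I_w$ assigning to each constant $c$ an element $c^{I_w}\in M_w$, and $J_w$ assigning to each $n$-ary relation symbol $S$ a set $S^{J_w}\subseteq (M_w)^n$. The model is adequate if $R$ is transitive, inclusive ($wRu\Rightarrow M_w\subseteq M_u$) and concordant ($wRu\Rightarrow c^{I_w}=c^{I_u}$ for all constants $c$). A $w$-assignment is a map $g$ from variables to $M_w$, extended to constants by $g(c):=c^{I_w}$; if $wRv$, $g^\iota$ denotes $g$ regarded as a $v$-assignment (via $M_w\subseteq M_v$). Assignments $g,h$ are $x$-alternative, $g\sim_x h$, if they agree on all variables except possibly $x$. Truth: $\mathcal M,w\Vdash^g\top$ always; $\mathcal M,w\Vdash^g S(t_0,\dots,t_{n-1})$ iff $\langle g(t_0),\dots,g(t_{n-1})\rangle\in S^{J_w}$;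 $\wedge$ componentwise; $\mathcal M,w\Vdash^g\Diamond\varphi$ iff there is $v$ with $wRv$ and $\mathcal M,v\Vdash^{g^\iota}\varphi$; $\mathcal M,w\Vdash^g\forall x\varphi$ iff $\mathcal M,w\Vdash^h\varphi$ for every $w$-assignment $h\sim_x g$. *)

(* Defs.v *)
From mathcomp Require Import all_boot.
From mathcomp Require Import classical_sets cardinality.

Set Implicit Arguments.
Unset Strict Implicit.
Unset Printing Implicit Defensive.

Local Open Scope classical_set_scope.

Definition var := nat.

Record signature := Signature {
  const : Type;
  relsym : Type;
  arity : relsym -> nat }.

Inductive term (Sg : signature) : Type :=
| Var of var
| Const of const Sg.
Arguments Var {Sg} _.
Arguments Const {Sg} _.

Inductive formula (Sg : signature) : Type :=
| Top
| Rel (S : relsym Sg) of (arity S).-tuple (term Sg)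
| And of formula Sg & formula Sg
| Diam of formula Sg
| All of var & formula Sg.
Arguments Top {Sg}.

Definition tvars (Sg : signature) (t : term Sg) : seq var :=
  if t is Var x then [:: x] else [::].

Fixpoint fv (Sg : signature) (phi : formula Sg) : seq var :=
  match phi with
  | Top => [::]
  | Rel _ ts => flatten (map (@tvars Sg) ts)
  | And phi psi => fv phi ++ fv psi
  | Diam phi => fv phi
  | All x phi => [seq y <- fv phi | y != x]
  end.

Definition tsubst (Sg : signature) (x : var) (t u : term Sg) : term Sg :=
  match u with
  | Var y => if y == x then t else Var y
  | Const c => Const c
  end.

(* Literal replacement of the free occurrences of [x], without renaming of
   bound variables: capture is excluded by [free_for] only. *)
Fixpoint subst (Sg : signature) (x : var) (t : term Sg) (phi : formula Sg) :
    formula Sg :=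
  match phi with
  | Top => Top
  | Rel _ ts => Rel (map_tuple (tsubst x t) ts)
  | And phi psi => And (subst x t phi) (subst x t psi)
  | Diam phi => Diam (subst x t phi)
  | All y phi => if y == x then All y phi else All y (subst x t phi)
  end.

Fixpoint free_for (Sg : signature) (t : term Sg) (x : var)
    (phi : formula Sg) : bool :=
  match phi with
  | Top | Rel _ _ => true
  | And phi psi => free_for t x phi && free_for t x psi
  | Diam phi => free_for t x phi
  | All y phi =>
      (x \notin fv (All y phi)) || ((y \notin tvars t) && free_for t x phi)
  end.

Fixpoint const_occurs (Sg : signature) (c : const Sg) (phi : formula Sg) :
    Prop :=
  match phi with
  | Top => False
  | Rel _ ts => exists i, tnth ts i = Const c
  | And phi psi => const_occurs c phi \/ const_occurs c psi
  | Diam phi => const_occurs c phi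
  | All _ phi => const_occurs c phi
  end.

Inductive QRC1 (Sg : signature) : formula Sg -> formula Sg -> Prop :=
| QRC1_top phi : QRC1 phi Top
| QRC1_refl phi : QRC1 phi phi
| QRC1_andl phi psi : QRC1 (And phi psi) phi
| QRC1_andr phi psi : QRC1 (And phi psi) psi
| QRC1_and phi psi chi :
    QRC1 phi psi -> QRC1 phi chi -> QRC1 phi (And psi chi)
| QRC1_cut phi psi chi : QRC1 phi psi -> QRC1 psi chi -> QRC1 phi chi
| QRC1_nec phi psi : QRC1 phi psi -> QRC1 (Diam phi) (Diam psi)
| QRC1_trans phi : QRC1 (Diam (Diam phi)) (Diam phi)
| QRC1_diam_all x phi : QRC1 (Diam (All x phi)) (All x (Diam phi))
| QRC1_allr x phi psi :
    x \notin fv phi -> QRC1 phi psi -> QRC1 phi (All x psi)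
| QRC1_alll x t phi psi :
    free_for t x phi -> QRC1 (subst x t phi) psi -> QRC1 (All x phi) psi
| QRC1_subst x t phi psi :
    free_for t x phi -> free_for t x psi ->
    QRC1 phi psi -> QRC1 (subst x t phi) (subst x t psi)
| QRC1_const x c phi psi :
    ~ const_occurs c phi -> ~ const_occurs c psi ->
    QRC1 (subst x (Const c) phi) (subst x (Const c) psi) -> QRC1 phi psi.

(* The domains of the worlds are subsets of one ambient type [carrier], so
   that inclusion of domains is literal inclusion; they may be empty. *)
Record frame := Frame {
  world : Type;
  world_inhabited : inhabited world;
  acc : world -> world -> Prop;
  carrier : Type;
  dom : world -> set carrier;
  dom_finite : forall w, finite_set (dom w) }.

Record model (Sg : signature) := Model {
  mframe :> frame;
  cint : world mframe -> const Sg -> carrier mframe;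
  cint_dom : forall w c, dom w (cint w c);
  rint : world mframe -> forall S : relsym Sg,
    set ((arity S).-tuple (carrier mframe));
  rint_dom : forall w S a, rint w (S := S) a -> forall i, dom w (tnth a i) }.

Definition acc_transitive (F : frame) : Prop :=
  forall w v u : world F, acc w v -> acc v u -> acc w u.

Definition inclusive (F : frame) : Prop :=
  forall w u : world F, acc w u -> dom w `<=` dom u.

Definition concordant (Sg : signature) (M : model Sg) : Prop :=
  forall w u : world M, acc w u -> forall c, cint w c = cint u c.

Definition adequate (Sg : signature) (M : model Sg) : Prop :=
  [/\ acc_transitive M, inclusive M & concordant M].

Definition assignment (F : frame) (w : world F) (g : var -> carrier F) : Prop :=
  forall x, dom w (g x).

Definition alternative (F : frame) (x : var) (g h : var -> carrier F) : Prop :=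
  forall y, y != x -> g y = h y.

Definition tval (Sg : signature) (M : model Sg) (w : world M)
    (g : var -> carrier M) (t : term Sg) : carrier M :=
  match t with
  | Var x => g x
  | Const c => cint w c
  end.

(* In an inclusive frame a [w]-assignment [g] is a [v]-assignment whenever
   [acc w v], so the lifting of [g] to [v] is [g] itself. *)
Fixpoint sat (Sg : signature) (M : model Sg) (w : world M)
    (g : var -> carrier M) (phi : formula Sg) : Prop :=
  match phi with
  | Top => True
  | Rel P ts => rint w (map_tuple (tval w g) ts)
  | And phi psi => sat w g phi /\ sat w g psi
  | Diam phi => exists v, acc w v /\ sat v g phi
  | All x phi =>
      forall h, assignment w h -> alternative x g h -> sat w h phi
  end.

(* Main.v *)
(* Soundness goes by induction on derivations.  The only rule that does not
   preserve truth in a fixed model is the elimination of a constant [c]: there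
   one passes to the submodel generated by [w] and reinterprets [c] as [g x]
   everywhere.  The premise applied to this model gives the conclusion because
   [c] does not occur in the two formulas.  The restriction to the generated
   submodel is needed for concordance and for [g x] to lie in every domain. *)
From mathcomp Require Import all_boot.
From mathcomp Require Import boolp.
Require Import Defs.

Set Implicit Arguments.
Unset Strict Implicit.
Unset Printing Implicit Defensive.

Definition upd (T : Type) (g : var -> T) (x : var) (a : T) : var -> T :=
  fun y => if y == x then a else g y.

Lemma tnth_fv (Sg : signature) (S : relsym Sg)
    (ts : (arity S).-tuple (term Sg)) i (x : var) :
  tnth ts i = Var x -> x \in fv (Rel ts).
Proof.
move=> tsi; rewrite /= -[tuple.tval ts]map_tnth_enum -map_comp.
by apply/flatten_mapP; exists i; rewrite ?mem_enum //= tsi inE.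
Qed.

Lemma subst_notin_fv (Sg : signature) (x : var) (t : term Sg)
    (phi : formula Sg) : x \notin fv phi -> subst x t phi = phi.
Proof.
elim: phi => [|S ts|phi IHphi psi IHpsi|phi IH|y phi IH] //=.
- move=> xN; congr Rel; apply: eq_from_tnth => i; rewrite tnth_map.
  case E: (tnth ts i) => [z|//] /=; case: eqP => // zx.
  by move: xN; rewrite -zx (tnth_fv E).
- by rewrite mem_cat negb_or => /andP[/IHphi-> /IHpsi->].
- by move/IH->.
- by case: eqP => // /eqP yx; rewrite mem_filter eq_sym yx /= => /IH->.
Qed.

Lemma free_for_const (Sg : signature) (c : const Sg) (x : var)
    (phi : formula Sg) : free_for (Const c) x phi.
Proof. by elim: phi => //= [phi -> psi ->|y phi ->] //; rewrite orbT. Qed.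

Lemma assignment_upd (F : frame) (w : world F) (g : var -> carrier F) x a :
  assignment w g -> dom w a -> assignment w (upd g x a).
Proof. by move=> gw aw y; rewrite /upd; case: eqP. Qed.

Lemma alternative_upd (F : frame) (g : var -> carrier F) x a :
  alternative x g (upd g x a).
Proof. by move=> y /negPf yx; rewrite /upd yx. Qed.

Lemma assignment_acc (F : frame) (w v : world F) (g : var -> carrier F) :
  inclusive F -> acc w v -> assignment w g -> assignment v g.
Proof. by move=> incl wv gw x; apply: incl wv _ (gw x). Qed.

Lemma dom_tval (Sg : signature) (M : model Sg) (w : world M)
    (g : var -> carrier M) t : assignment w g -> dom w (tval w g t).
Proof. by case: t => [x|c] gw //=; apply: cint_dom. Qed.

Lemma tval_acc (Sg : signature) (M : model Sg) (w v : world M)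
    (g : var -> carrier M) t :
  concordant M -> acc w v -> tval v g t = tval w g t.
Proof. by move=> conc wv; case: t => //= c; rewrite (conc _ _ wv). Qed.

Lemma tval_notin_tvars (Sg : signature) (M : model Sg) (w : world M)
    (g h : var -> carrier M) y t :
  alternative y g h -> y \notin tvars t -> tval w g t = tval w h t.
Proof. by case: t => //= z gh; rewrite inE eq_sym => /gh. Qed.

Lemma sat_fv_imp (Sg : signature) (M : model Sg) (phi : formula Sg)
    (w : world M) (g h : var -> carrier M) :
  inclusive M -> assignment w g -> assignment w h ->
  {in fv phi, g =1 h} -> sat w g phi -> sat w h phi.
Proof.
move=> incl; elim: phi w g h => [|S ts|phi IHphi psi IHpsi|phi IH|x phi IH] //=
  w g h gw hw gh.
- suff -> : map_tuple (tval w g) ts = map_tuple (tval w h) ts by [].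
  apply: eq_from_tnth => i; rewrite !tnth_map.
  by case E: (tnth ts i) => [z|//] /=; apply: gh; apply: tnth_fv E.
- case=> pg qg; split.
    by apply: IHphi gw hw _ pg => y yf; apply: gh; rewrite mem_cat yf.
  by apply: IHpsi gw hw _ qg => y yf; apply: gh; rewrite mem_cat yf orbT.
- case=> v [wv sv]; exists v; split=> //.
  by apply: IH gh sv; apply: assignment_acc wv _.
(* [k] need not agree with [g] outside [fv (All x phi)], so [sg] is applied to [g] with only the
   value at [x] taken from [k]. *)
- move=> sg k kw hk; apply: (IH w (upd g x (k x)) k) => //.
  + exact: assignment_upd.
  + move=> y yf; rewrite /upd; case: eqP => [->//|/eqP yx].
    by rewrite gh ?hk // mem_filter yx.
  + by apply: sg; [exact: assignment_upd | exact: alternative_upd].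
Qed.

Lemma sat_fv (Sg : signature) (M : model Sg) (phi : formula Sg)
    (w : world M) (g h : var -> carrier M) :
  inclusive M -> assignment w g -> assignment w h ->
  {in fv phi, g =1 h} -> sat w g phi <-> sat w h phi.
Proof.
move=> incl gw hw gh; split; apply: sat_fv_imp => // y yf.
by rewrite gh.
Qed.

(** The value of [t] must be the same wherever a replaced occurrence sits: concordance ensures this
    under a diamond, and freedom from capture under a quantifier. *)
Lemma sat_subst (Sg : signature) (M : model Sg) x (t : term Sg)
    (phi : formula Sg) (w : world M) (g : var -> carrier M) :
  inclusive M -> concordant M -> assignment w g -> free_for t x phi ->
  sat w g (subst x t phi) <-> sat w (upd g x (tval w g t)) phi.
Proof.
move=> incl conc; elim: phi w g => [|S ts|phi IHphi psi IHpsi|phi IH|y phi IH]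
  w g gw.
- by [].
- move=> _ /=.
  suff -> : map_tuple (tval w g) (map_tuple (tsubst x t) ts) =
    map_tuple (tval w (upd g x (tval w g t))) ts by [].
  apply: eq_from_tnth => i; rewrite !tnth_map.
  by case: (tnth ts i) => [z|//] /=; rewrite /upd; case: eqP.
- by move=> /= /andP[/(IHphi _ _ gw) E1 /(IHpsi _ _ gw) E2]; rewrite E1 E2.
- move=> /= tx; split=> -[v [wv sv]]; exists v; split=> //.
    rewrite -(tval_acc g t conc wv); apply/IH => //.
    exact: assignment_acc wv _.
  apply/IH => //; first exact: assignment_acc wv _.
  by rewrite (tval_acc g t conc wv).
(* If [x] is not free in [All y phi], then [free_for] says nothing about [t]; but the substitution
   does nothing and the update at [x] is invisible. *)
- have [xN _|xf /=] := boolP (x \notin fv (All y phi)).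
    rewrite subst_notin_fv //; apply: sat_fv => //.
      by apply: assignment_upd => //; apply: dom_tval.
    move=> z zf; rewrite /upd; case: eqP => // zx.
    by move: xN; rewrite -zx zf.
  move: xf; rewrite negbK /= mem_filter => /andP[xy xf].
  rewrite xf xy /= => /andP[yt tx]; rewrite eq_sym (negPf xy) /=.
  split=> s h hw gh.
  (* [h] may differ from [g] at [x] as well as at [y]. The assignment [k] keeps only the change at
     [y], as [s] demands; the change at [x] comes back through the induction hypothesis. *)
  + set k := upd g y (h y).
    have kw : assignment w k by apply: assignment_upd.
    have gk : alternative y g k by apply: alternative_upd.
    have /(IH _ _ kw tx) := s k kw gk.
    apply: sat_fv_imp => //.
      by apply: assignment_upd => //; apply: dom_tval.
    move=> z _; rewrite -(tval_notin_tvars w gk yt) /upd /k /upd.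
    have [->|zx] := eqVneq z x; first by rewrite -gh // /upd eqxx.
    have [->//|zy] := eqVneq z y.
    by rewrite -gh // /upd (negPf zx).
  + apply/(IH _ _ hw tx); rewrite -(tval_notin_tvars w gh yt); apply: s.
      by apply: assignment_upd => //; apply: dom_tval.
    by move=> z zy; rewrite /upd; case: eqP => // _; apply: gh.
Qed.

Section Reinterpretation.
Variables (Sg : signature) (M : model Sg) (w : world M) (c : const Sg).
Variables (a : carrier M).
Hypotheses (adM : adequate M) (aw : dom w a).

(** The root is added by hand since [acc] may be irreflexive. By transitivity no longer paths are
    needed. *)
Definition cone : Type := {v : world M | v = w \/ acc w v}.

Lemma cone_root : inhabited cone.
Proof. by constructor; exists w; left. Qed.

Definition cone_frame : frame :=
  @Frame cone cone_root (fun u v => acc (sval u) (sval v)) (carrier M)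
    (fun v => dom (sval v)) (fun v => dom_finite (sval v)).

(** The case distinction is classical: [const Sg] is an arbitrary type, without decidable
    equality. *)
Definition cone_cint (v : world cone_frame) (d : const Sg) :
    carrier cone_frame :=
  if pselect (d = c) then a else cint (sval v) d.

Lemma cone_cint_dom v d : dom v (cone_cint v d).
Proof.
rewrite /cone_cint; case: pselect => [?|?] /=; last exact: cint_dom.
have [_ incl _] := adM.
by case: v => v /= [->//|wv]; apply: incl wv _ aw.
Qed.

Definition cone_model : model Sg :=
  @Model Sg cone_frame cone_cint cone_cint_dom
    (fun v S => @rint Sg M (sval v) S) (fun v S => @rint_dom Sg M (sval v) S).

Lemma cone_model_adequate : adequate cone_model.
Proof.
have [tr incl conc] := adM; split.
- by move=> u v z; apply: tr.
- by move=> u v; apply: incl.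
- move=> u v uv d /=; rewrite /cone_cint; case: pselect => [//|?] /=.
  exact: conc uv d.
Qed.

(** Truth at a world looks only at its successors, and the cone is closed under [acc]; the new value
    of [c] is never consulted. *)
Lemma sat_cone_model (phi : formula Sg) (v : world cone_model) g :
  ~ const_occurs c phi -> sat v g phi <-> @sat Sg M (sval v) g phi.
Proof.
have [tr _ _] := adM.
elim: phi v g => [|S ts|phi IHphi psi IHpsi|phi IH|y phi IH] v g //= cN.
- suff -> : map_tuple (@tval Sg cone_model v g) ts =
    map_tuple (@tval Sg M (sval v) g) ts by [].
  apply: eq_from_tnth => i; rewrite !tnth_map.
  case E: (tnth ts i) => [//|d] /=; rewrite /cone_cint.
  by case: pselect => // dc; case: cN; exists i; rewrite E dc.
- by rewrite IHphi ?IHpsi //; tauto.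
- split=> [[u [vu su]]|[u [vu su]]].
    by exists (sval u); split=> //; apply/IH.
  have wu : u = w \/ acc w u.
    by right; case: v vu => v /= [->//|wv] vu; apply: tr wv vu.
  by exists (exist _ u wu); split=> //; apply/IH.
- by split=> s h hv gh; apply/(IH v h cN); apply: s.
Qed.

End Reinterpretation.

Theorem theorem4p13 (Sg : signature) (phi psi : formula Sg) :
  QRC1 phi psi ->
  forall (M : model Sg), adequate M ->
  forall (w : world M) (g : var -> carrier M), assignment w g ->
  sat w g phi -> sat w g psi.
Proof.
(* The model, world and assignment stay general in the induction hypotheses: the constant rule
   changes the model, the modal rule the world, the substitution rule the assignment. *)
elim=> {phi psi} [phi|phi|phi psi|phi psi|phi psi chi _ IH1 _ IH2
  |phi psi chi _ IH1 _ IH2|phi psi _ IH|phi|x phi|x phi psi xN _ IH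
  |x t phi psi tx _ IH|x t phi psi tphi tpsi _ IH|x c phi psi cphi cpsi _ IH]
  M adM w g gw //; have [tr incl conc] := adM.
- by case.
- by case.
- by move=> s; split; [apply: IH1 | apply: IH2].
- by move=> s; apply: IH2 => //; apply: IH1.
- case=> v [wv sv]; exists v; split=> //; apply: IH => //.
  exact: assignment_acc wv gw.
- by case=> v [wv [u [vu su]]]; exists u; split=> //; apply: tr wv vu.
(* One witness [v] serves every [h]: by inclusion [h] is also a [v]-assignment, hence covered by the
   quantifier at [v]. *)
- case=> v [wv sv] h hw gh; exists v; split=> //; apply: sv => //.
  exact: assignment_acc wv hw.
- move=> s h hw gh; apply: IH => //; move: s; apply: sat_fv_imp => // y yf.
  by apply: gh; apply: contraNneq xN => <-.
- move=> s; apply: IH => //; apply/sat_subst => //; apply: s.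
    by apply: assignment_upd => //; apply: dom_tval.
  exact: alternative_upd.
- move=> /sat_subst s; apply/sat_subst => //; apply: IH => //; last exact: s.
  by apply: assignment_upd => //; apply: dom_tval.
- pose N := cone_model c adM (gw x).
  have adN : adequate N by apply: cone_model_adequate.
  have [_ inclN concN] := adN.
  pose w' : world N := exist _ w (or_introl erefl).
  have gw' : @assignment N w' g by [].
  (* In [N] the constant [c] denotes [g x], so replacing [x] by [c] leaves truth under [g]
     unchanged. *)
  have updg : upd g x (@tval Sg N w' g (Const c)) = g.
    apply/funext => y; rewrite /upd /= /cone_cint.
    by case: eqP => // ->; case: pselect.
  have satN chi : ~ const_occurs c chi ->
      @sat Sg N w' g (subst x (Const c) chi) <-> sat w g chi.
    move=> cN; rewrite (sat_subst inclN concN gw') ?updg.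
      exact: sat_cone_model.
    exact: free_for_const.
  by move=> s; apply/(satN _ cpsi)/IH => //; apply/satN.
Qed.
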